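(* For every integer $n > 0$ and every edge $e$ of the Birkhoff polytope $B_n$, the inner product $\mathbf{V}_n \cdot \operatorname{dir} e$ is nonzero.
   Context: The $n$th Birkhoff polytope $B_n \subset \mathbb{R}^{n\times n}$ is the convex hull (equivalently, the set) of all nonnegative real $n \times n$ matrices all of whose rows and columns sum to $1$. An edge is a $1$-dimensional face. For an edge $e$ with endpoints (vertices) $P \neq Q$, $\operatorname{dir} e$ denotes a direction vector of $e$, i.e. the matrix $P - Q$ (well defined up to a nonzero scalar, which does not affect whether the inner product vanishes). The inner product of two $n\times n$ real matrices is the entrywise one, $\mathbf{A}\cdot\mathbf{B} = \sum_{i,j} \mathbf{A}[i,j]\,\mathbf{B}[i,j]$. For each integer $n > 1$, $\mathbf{V}_n = (a_{ij})_{1\le i,j\le n}$ is the $n \times n$ matrix with $a_{1j} = 0$ for all $j$ and $a_{ij} = (j-1)\,n^{i-2}$ for $2 \le i \le n$, $1 \le j \le n$; that is, the first row is zero, the second row is $0,1,2,\ldots,n-1$, the third row is $0,n,2n,\ldots,(n-1)n$, and so on down to the last row $0, n^{n-2}, 2n^{n-2},\ldots,(n-1)n^{n-2}$. Also $\mathbf{V}_1 = (1)$. *)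

(* Defs.v *)
From HB Require Import structures.
From mathcomp Require Export all_boot all_order all_algebra.
From mathcomp Require Export classical_sets reals.

Set Implicit Arguments.
Unset Strict Implicit.
Unset Printing Implicit Defensive.

Import Order.TTheory GRing.Theory Num.Theory.

Local Open Scope classical_set_scope.
Local Open Scope ring_scope.

Definition mxdot (R : realType) (n : nat) (A B : 'M[R]_n) : R :=
  \sum_(i < n) \sum_(j < n) A i j * B i j.

Definition birkhoff (R : realType) (n : nat) : set 'M[R]_n :=
  [set A | [/\ forall i j, 0 <= A i j,
               forall i, \sum_(j < n) A i j = 1 &
               forall j, \sum_(i < n) A i j = 1]].

(* A face is cut out by a valid inequality C . A <= c. The empty set and the
   whole polytope (C = 0) are allowed. *)
Definition is_face (R : realType) (n : nat) (P F : set 'M[R]_n) : Prop :=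
  exists (C : 'M[R]_n) (c : R),
    (forall A, P A -> mxdot C A <= c) /\ F = [set A | P A /\ mxdot C A = c].

Definition affine_hull (R : realType) (n : nat) (S : set 'M[R]_n) :
    set 'M[R]_n :=
  [set A | exists (k : nat) (X : 'I_k -> 'M[R]_n) (a : 'I_k -> R),
     [/\ forall i, S (X i), \sum_(i < k) a i = 1 &
         A = \sum_(i < k) a i *: X i]].

(* The affine hull is a translate of a d-dimensional linear subspace; this
   never holds when S is empty. *)
Definition affine_dim (R : realType) (n : nat) (S : set 'M[R]_n) (d : nat) :
    Prop :=
  exists (A0 : 'M[R]_n) (U : {vspace 'M[R]_n}),
    (\dim U = d)%N /\ affine_hull S = [set A | A - A0 \in U].

Definition is_edge (R : realType) (n : nat) (P e : set 'M[R]_n) : Prop :=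
  is_face P e /\ affine_dim e 1.

Definition is_vertex (R : realType) (n : nat) (P : set 'M[R]_n)
    (A : 'M[R]_n) : Prop :=
  is_face P [set A].

(* The endpoints of an edge e of P are the vertices of P lying on e. Both
   orientations of the direction satisfy this predicate. *)
Definition is_edge_dir (R : realType) (n : nat) (P e : set 'M[R]_n)
    (D : 'M[R]_n) : Prop :=
  exists A B : 'M[R]_n,
    [/\ is_vertex P A /\ e A, is_vertex P B /\ e B, A <> B & D = A - B].

(* Indices start at 0: row i and column j here are row i + 1 and column j + 1
   in one-based notation, so the entry (j - 1) n ^ (i - 2) becomes
   j * n ^ i.-1. *)
Definition Vmx (R : realType) (n : nat) : 'M[R]_n :=
  \matrix_(i < n, j < n)
    if n == 1%N then 1
    else if i == 0%N :> nat then 0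
    else (j * n ^ i.-1)%N%:R.

(* Main.v *)
Require Import Defs.
From mathcomp Require Import lra.

Set Implicit Arguments.
Unset Strict Implicit.
Unset Printing Implicit Defensive.

Import Order.TTheory GRing.Theory Num.Theory.
Local Open Scope classical_set_scope.
Local Open Scope ring_scope.

(** Every vertex of the Birkhoff polytope is a 0/1 matrix, and the functional
    [mxdot (Vmx R n)] separates the 0/1 matrices in the polytope; hence it takes
    different values at any two distinct vertices, in particular at the two ends
    of an edge.

    Separation ([mxdot_Vmx_inj]).  A 0/1 matrix of the polytope has a single 1
    in each row, say in column [s i] of row [i], and for [n > 1] the functional
    maps it to the sum of [s i * n ^ i.-1] over [i > 0].  That is an expansion
    in base [n], so the value determines all rows but the first
    ([base_expansion_inj]), and the column sums then determine the first row.
    For [n = 1] the polytope is a single point.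

    Vertices ([vertex_birkhoff_01]).  If a matrix of the polytope has an entry
    strictly between 0 and 1, every row or column through such an entry contains
    a second one, because the line sums to 1.  Seen as the edges of a bipartite
    graph between rows and columns, the fractional entries thus form a graph of
    degree at least two at its non-isolated vertices, which carries a nonzero
    circulation ([circulation_exists]): a matrix [N] supported on the fractional entries,
    with zero row and column sums.  Then [A + eps N] and [A - eps N] both lie in
    the polytope for small [eps], so [A] is not a vertex. *)

(** * Circulations on a bipartite graph *)

Lemma card_imset_double (T U : finType) (f : T -> U) (F : {set T}) :
  (forall p, p \in F -> exists2 q, q \in F & q != p /\ f q = f p) ->
  (#|f @: F| * 2 <= #|F|)%N.
Proof.
move=> twoF; rewrite -sum_nat_const -[X in (_ <= X)%N]sum1_card.
rewrite (partition_big f (mem (f @: F))) /=; last by move=> p; apply: imset_f.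
apply: leq_sum => _ /imsetP[p pF ->].
have [q qF [qp fqp]] := twoF p pF.
(* The fibre through [p] contains [p] and [q]. *)
rewrite (bigD1 p) ?pF ?eqxx //= (bigD1 q) ?qF ?fqp ?eqxx //=.
Qed.

Definition incidence_mx (K : fieldType) (T U : finType) (f : T -> U)
    (F : {set T}) : 'M[K]_(#|F|, #|f @: F|) :=
  \matrix_(k, l) (f (enum_val k) == enum_val l)%:R.

Lemma incidence_mx_const1 (K : fieldType) (T U : finType) (f : T -> U)
    (F : {set T}) :
  incidence_mx K f F *m const_mx 1 = const_mx 1 :> 'cV_#|F|.
Proof.
apply/colP=> k; rewrite !mxE.
have kF : f (enum_val k) \in f @: F by apply/imset_f/enum_valP.
rewrite (bigD1 (enum_rank_in kF (f (enum_val k)))) //= !mxE enum_rankK_in //.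
rewrite eqxx mulr1 big1 ?addr0 // => l lk; rewrite !mxE.
case: eqP => [E|_]; last by rewrite mul0r.
by case/eqP: lk; apply: enum_val_inj; rewrite enum_rankK_in // E.
Qed.

Lemma incidence_mx_ker (K : fieldType) (T U : finType) (f : T -> U)
    (F : {set T}) (u : 'rV[K]_#|F|) :
  u *m incidence_mx K f F = 0 ->
  forall x, \sum_k u 0 k * (f (enum_val k) == x)%:R = 0.
Proof.
move=> uM x; have [xF|xF] := boolP (x \in f @: F).
  move/rowP/(_ (enum_rank_in xF x)): uM; rewrite !mxE => uM0; rewrite -[RHS]uM0.
  by apply: eq_bigr => k _; rewrite mxE enum_rankK_in.
rewrite big1 // => k _; case: eqP => [E|]; last by rewrite mulr0.
by move: xF; rewrite -E imset_f ?enum_valP.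
Qed.

(** The incidence matrix of the graph has at least as many rows (edges) as
    columns (non-isolated vertices), as all degrees are at least two.  Were its
    rows independent, it would be square and invertible; but each edge has one
    end of each kind, so the matrix kills the vector with value 1 on row vertices
    and -1 on column vertices.  A dependency between the rows is the required
    circulation, since the entry of the dependent combination at a vertex is the
    sum of the coefficients of the edges there. *)
Lemma circulation_exists (K : fieldType) (m n : nat) (F : {set 'I_m * 'I_n}) :
  F != finset.set0 ->
  (forall p, p \in F -> exists2 q, q \in F & q != p /\ q.1 = p.1) ->
  (forall p, p \in F -> exists2 q, q \in F & q != p /\ q.2 = p.2) ->
  exists N : 'M[K]_(m, n),
    [/\ N != 0, forall i j, (i, j) \notin F -> N i j = 0,
        forall i, \sum_j N i j = 0 & forall j, \sum_i N i j = 0].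
Proof.
move=> /set0Pn[p0 p0F] row2 col2.
pose M := row_mx (incidence_mx K (@fst 'I_m 'I_n) F)
                 (incidence_mx K (@snd 'I_m 'I_n) F).
have notfree : ~~ row_free M.
  apply/negP=> freeM.
  have fullM : row_full M.
    rewrite /row_full eqn_leq rank_leq_col /=; move/eqP: freeM => ->.
    rewrite -leq_double doubleD -[leqRHS]addnn -!muln2.
    by apply: leq_add; apply: card_imset_double.
  have : M *m (col_mx (const_mx 1) (- const_mx 1) : 'cV_(_ + _)) = 0.
    by rewrite mul_row_col mulmxN !incidence_mx_const1 subrr.
  rewrite -(mulmx0 _ M) => /(row_full_inj fullM) /matrixP.
  have p0R : p0.1 \in fst @: F by apply: imset_f.
  move=> /(_ (lshift _ (enum_rank_in p0R p0.1)) 0).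
  by rewrite col_mxEu !mxE => /eqP; rewrite oner_eq0.
have [u uM u0] : exists2 u : 'rV_#|F|, u *m M = 0 & u != 0.
  move: notfree; rewrite -kermx_eq0 => /rowV0Pn[u /sub_kermxP uM u0].
  by exists u.
move: uM; rewrite mul_mx_row -row_mx0 => /eq_row_mx[uM1 uM2].
pose N : 'M[K]_(m, n) :=
  \matrix_(i, j) \sum_k u 0 k * (enum_val k == (i, j))%:R.
have NE k : N (enum_val k).1 (enum_val k).2 = u 0 k.
  rewrite mxE -surjective_pairing (bigD1 k) //= eqxx mulr1 big1 ?addr0 // => l.
  by rewrite (inj_eq enum_val_inj) => /negPf->; rewrite mulr0.
exists N; split.
- apply: contraNneq u0 => N0; apply/eqP/rowP=> k.
  by rewrite -NE N0 !mxE.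
- move=> i j ijF; rewrite mxE big1 // => k _; case: eqP => [E|]; last first.
    by rewrite mulr0.
  by move: ijF; rewrite -E enum_valP.
- move=> i; rewrite -[RHS](incidence_mx_ker uM1 i).
  under eq_bigr do rewrite mxE.
  rewrite exchange_big; apply: eq_bigr => k _ /=.
  rewrite -mulr_sumr; congr (_ * _); case: (enum_val k) => a b /=.
  rewrite (bigD1 b) //= big1 ?addr0 => [|j /negPf jb].
    by rewrite xpair_eqE eqxx andbT.
  by rewrite xpair_eqE [b == j]eq_sym jb andbF.
- move=> j; rewrite -[RHS](incidence_mx_ker uM2 j).
  under eq_bigr do rewrite mxE.
  rewrite exchange_big; apply: eq_bigr => k _ /=.
  rewrite -mulr_sumr; congr (_ * _); case: (enum_val k) => a b /=.
  rewrite (bigD1 a) //= big1 ?addr0 => [|i /negPf ia].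
    by rewrite xpair_eqE eqxx.
  by rewrite xpair_eqE [a == i]eq_sym ia.
Qed.

(** * Vertices of the Birkhoff polytope *)

(** The terms other than [f j] sum to [1 - f j], which lies strictly between 0
    and 1, so one of them is positive and at most [1 - f j]. *)
Lemma second_fractional (R : realFieldType) (T : finType) (f : T -> R) (j : T) :
  (forall k, 0 <= f k) -> \sum_k f k = 1 -> 0 < f j < 1 ->
  exists2 k, k != j & 0 < f k < 1.
Proof.
move=> f0 f1 /andP[fj0 fj1].
have [/existsP[k /andP[kj fk0]]|nok] := boolP [exists k, (k != j) && (0 < f k)].
  exists k => //; rewrite fk0 /=.
  move: f1; rewrite (bigD1 j) //= (bigD1 k) //=.
  have : 0 <= \sum_(i | (i != j) && (i != k)) f i by apply: sumr_ge0.
  lra.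
move: f1; rewrite (bigD1 j) //= big1 => [|k kj].
  by rewrite addr0 => E; move: fj1; rewrite E ltxx.
apply/eqP; rewrite eq_le f0 andbT leNgt; apply: contraNN nok => fk.
by apply/existsP; exists k; rewrite kj.
Qed.

(** The witness is [(1 + \sum_k `|b k| / a k)^-1]: the sum bounds each of the
    ratios, and the indices with [a k = 0] contribute nothing to it. *)
Lemma exists_small_scale (R : realFieldType) (T : finType) (a b : T -> R) :
  (forall k, 0 <= a k) -> (forall k, a k = 0 -> b k = 0) ->
  exists2 eps, 0 < eps & forall k, eps * `|b k| <= a k.
Proof.
move=> a0 ab; pose S := \sum_k `|b k| / a k.
have S0 : 0 <= S by apply: sumr_ge0 => k _; rewrite divr_ge0.
have S1 : 0 < 1 + S by rewrite ltr_wpDr.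
exists (1 + S)^-1; first by rewrite invr_gt0.
move=> k; have [ak|ak] := eqVneq (a k) 0; first by rewrite ab // normr0 mulr0 ak.
have akgt : 0 < a k by rewrite lt0r ak a0.
rewrite mulrC ler_pdivrMr // mulrC -ler_pdivrMr //.
rewrite /S (bigD1 k) //= addrCA ler_wpDr //.
by rewrite addr_ge0 // sumr_ge0 // => l _; rewrite divr_ge0.
Qed.

Lemma mxdotDr (R : realType) (n : nat) (C A B : 'M[R]_n) :
  mxdot C (A + B) = mxdot C A + mxdot C B.
Proof.
rewrite /mxdot -big_split; apply: eq_bigr => i _ /=.
by rewrite -big_split; apply: eq_bigr => j _; rewrite mxE mulrDr.
Qed.

Lemma mxdotNr (R : realType) (n : nat) (C A : 'M[R]_n) :
  mxdot C (- A) = - mxdot C A.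
Proof.
rewrite /mxdot -sumrN; apply: eq_bigr => i _ /=.
by rewrite -sumrN; apply: eq_bigr => j _; rewrite mxE mulrN.
Qed.

Lemma birkhoffD (R : realType) (n : nat) (A N : 'M[R]_n) :
  birkhoff A -> (forall i j, `|N i j| <= A i j) ->
  (forall i, \sum_j N i j = 0) -> (forall j, \sum_i N i j = 0) ->
  birkhoff (A + N).
Proof.
move=> [A0 Ar Ac] NA Nr Nc; split.
- move=> i j; rewrite mxE; have := NA i j.
  have := ler_norm (- N i j); rewrite normrN; lra.
- by move=> i; under eq_bigr do rewrite mxE; rewrite big_split /= Ar Nr addr0.
- by move=> j; under eq_bigr do rewrite mxE; rewrite big_split /= Ac Nc addr0.
Qed.

(** A linear functional that is maximal at an inner point of a segment is
    constant on that segment. *)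
Lemma vertex_no_segment (R : realType) (n : nat) (P : set 'M[R]_n)
    (A N : 'M[R]_n) :
  is_vertex P A -> P (A + N) -> P (A - N) -> N = 0.
Proof.
move=> [C [c [valid Aface]]] PAN PAN'.
have [PA CA] : P A /\ mxdot C A = c.
  by have : [set A] A by []; rewrite Aface.
have := valid _ PAN; have := valid _ PAN'; rewrite !mxdotDr mxdotNr CA => le1 le2.
have : [set A] (A + N).
  by rewrite Aface; split => //; rewrite mxdotDr CA; lra.
by move=> /= /eqP; rewrite -subr_eq0 addrAC subrr add0r => /eqP.
Qed.

Lemma vertex_sub (R : realType) (n : nat) (P : set 'M[R]_n) (A : 'M[R]_n) :
  is_vertex P A -> P A.
Proof.
by move=> [C [c [_ Aface]]]; have : [set A] A by []; rewrite Aface => -[].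
Qed.

(** Moving along a circulation supported on the fractional entries, in either
    direction, stays in the polytope for a short while. *)
Lemma vertex_birkhoff_01 (R : realType) (n : nat) (A : 'M[R]_n) :
  is_vertex (@birkhoff R n) A -> forall i j, A i j = 0 \/ A i j = 1.
Proof.
move=> vA; have PA := vertex_sub vA; have [A0 Ar Ac] := PA.
have A1 i j : A i j <= 1 by rewrite -(Ar i) (bigD1 j) //= lerDl sumr_ge0.
pose F : {set 'I_n * 'I_n} := [set p | 0 < A p.1 p.2 < 1]%SET.
have [F0|F_n0] := eqVneq F finset.set0.
  move=> i j; have := finset.in_set0 (i, j); rewrite -F0 inE /= lt0r A0 andbT.
  rewrite lt_neqAle A1 andbT => /negbT; rewrite negb_and !negbK.
  by case/orP=> /eqP; [left|right].
have [|||N [N0 NF Nr Nc]] := @circulation_exists R n n F.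
- by [].
- move=> [i j]; rewrite inE /= => Aij.
  have [k kj Aik] := second_fractional (A0 i) (Ar i) Aij.
  by exists (i, k); rewrite ?inE //= xpair_eqE eqxx.
- move=> [i j]; rewrite inE /= => Aij.
  have [k ki Akj] := second_fractional (fun k => A0 k j) (Ac j) Aij.
  by exists (k, j); rewrite ?inE //= xpair_eqE eqxx andbT.
have [||eps eps0 epsN] :=
  @exists_small_scale R _ (fun p : 'I_n * 'I_n => A p.1 p.2)
    (fun p => N p.1 p.2).
- by move=> p.
- by move=> [i j] /= Aij; apply: NF; rewrite inE /= Aij ltxx.
have epsNE i j : `|(eps *: N) i j| <= A i j.
  by rewrite mxE normrM gtr0_norm //; apply: epsN (i, j).
have epsNr i : \sum_j (eps *: N) i j = 0.
  by under eq_bigr do rewrite mxE; rewrite -mulr_sumr Nr mulr0.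
have epsNc j : \sum_i (eps *: N) i j = 0.
  by under eq_bigr do rewrite mxE; rewrite -mulr_sumr Nc mulr0.
have : eps *: N = 0.
  apply: vertex_no_segment vA _ _; apply: birkhoffD => //.
  - by move=> i j; rewrite mxE normrN.
  - by move=> i; under eq_bigr do rewrite mxE; rewrite sumrN epsNr oppr0.
  - by move=> j; under eq_bigr do rewrite mxE; rewrite sumrN epsNc oppr0.
by move/eqP; rewrite scaler_eq0 (gt_eqF eps0) (negPf N0).
Qed.

(** * Separation of 0/1 matrices *)

Lemma base_expansion_lt (n m : nat) (s : nat -> nat) :
  (forall i, s i < n)%N -> (\sum_(i < m) s i * n ^ i < n ^ m)%N.
Proof.
move=> sn; elim: m => [|m IH]; first by rewrite big_ord0.
rewrite big_ord_recr /= expnS -addSn.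
apply: leq_trans (leq_add IH (leqnn _)) _.
by rewrite -mulSn leq_mul2r sn orbT.
Qed.

(** By induction on the number of digits: dividing an expansion with [m.+1]
    digits by [n ^ m] extracts the leading one, by [base_expansion_lt]. *)
Lemma base_expansion_inj (n m : nat) (s t : nat -> nat) :
  (forall i, s i < n)%N -> (forall i, t i < n)%N ->
  (\sum_(i < m) s i * n ^ i = \sum_(i < m) t i * n ^ i)%N ->
  forall i, (i < m)%N -> s i = t i.
Proof.
move=> sn tn; elim: m => [//|m IH]; rewrite !big_ord_recr /= => E.
have nm0 : (0 < n ^ m)%N by rewrite expn_gt0 (leq_ltn_trans _ (sn 0%N)).
have Em : s m = t m.
  have := congr1 (fun x => x %/ n ^ m)%N E.
  rewrite /= ![(\sum_(i < m) _ + _)%N]addnC !divnMDl //.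
  by rewrite !divn_small ?addn0 //; apply: base_expansion_lt.
move: E; rewrite Em => /addIn /IH {}IH i.
by rewrite ltnS leq_eqVlt => /predU1P[->|/IH].
Qed.

Lemma row_01 (R : realType) (n : nat) (A : 'M[R]_n) :
  birkhoff A -> (forall i j, A i j = 0 \/ A i j = 1) ->
  exists s : 'I_n -> 'I_n, forall i j, A i j = (j == s i)%:R.
Proof.
move=> [A0 Ar _] A01.
have rowA i : exists j, A i j == 1.
  apply/existsP; apply: contraT => /existsPn Ai.
  have := Ar i; rewrite big1 => [/esym/eqP|j _]; first by rewrite oner_eq0.
  by case: (A01 i j) => // /eqP; rewrite (negPf (Ai j)).
exists (fun i => xchoose (rowA i)) => i j.
have /eqP := xchooseP (rowA i); set k := xchoose _ => Aik.
have [->//|jk] := eqVneq j k.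
have := Ar i; rewrite (bigD1 k) //= (bigD1 j) //= Aik.
have : 0 <= \sum_(l | (l != k) && (l != j)) A i l by apply: sumr_ge0.
have := A0 i j; rewrite /=; lra.
Qed.

Lemma inord_lift0 (n : nat) (i : 'I_n.+1) : inord i.+1 = lift ord0 i.
Proof.
by apply: val_inj; rewrite [RHS]lift0 /= inordK //; apply: (ltn_ord i).
Qed.

(** For [n > 1] the zero first row drops out; the remaining rows, renumbered
    from 0, are the digits of a base [n] expansion. *)
Lemma mxdot_Vmx_01 (R : realType) (n : nat) (A : 'M[R]_n.+2)
    (s : 'I_n.+2 -> 'I_n.+2) :
  (forall i j, A i j = (j == s i)%:R) ->
  mxdot (Vmx R n.+2) A =
    (\sum_(i < n.+1) (s (inord i.+1) : nat) * n.+2 ^ i)%N%:R.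
Proof.
move=> As; rewrite /mxdot [LHS]big_ord_recl.
rewrite [X in X + _]big1 ?add0r => [|j _]; last first.
  by rewrite mxE /= mul0r.
rewrite natr_sum; apply: eq_bigr => i _.
rewrite inord_lift0.
rewrite (bigD1 (s (lift ord0 i))) //= big1 => [|j /negPf js].
  by rewrite addr0 As eqxx mulr1 mxE.
by rewrite As js mulr0.
Qed.

Lemma mxdot_Vmx_inj (R : realType) (n : nat) (A B : 'M[R]_n) :
  birkhoff A -> birkhoff B ->
  (forall i j, A i j = 0 \/ A i j = 1) ->
  (forall i j, B i j = 0 \/ B i j = 1) ->
  mxdot (Vmx R n) A = mxdot (Vmx R n) B -> A = B.
Proof.
move=> PA PB A01 B01.
have [s As] := row_01 PA A01; have [t Bt] := row_01 PB B01.
case: n => [|[|n]] in A B PA PB A01 B01 s t As Bt *.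
- by move=> _; apply/matrixP=> -[].
- by move=> _; apply/matrixP=> i j; rewrite As Bt !ord1.
rewrite (mxdot_Vmx_01 As) (mxdot_Vmx_01 Bt) => /eqP; rewrite eqr_nat => /eqP.
move=> /(@base_expansion_inj n.+2 n.+1 (fun i => s (inord i.+1))
           (fun i => t (inord i.+1)) (fun=> ltn_ord _) (fun=> ltn_ord _)) st.
have AB (i : 'I_n.+1) j : A (lift ord0 i) j = B (lift ord0 i) j.
  rewrite As Bt; congr (_ == _)%:R; apply: val_inj.
  have /= := st i (ltn_ord i).
  by rewrite inord_lift0.
have AB0 j : A ord0 j = B ord0 j.
  have [_ _ /(_ j)] := PA; have [_ _ /(_ j)] := PB.
  move=> EB EA; have := etrans EA (esym EB).
  rewrite [LHS]big_ord_recl [RHS]big_ord_recl.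
  by rewrite (eq_bigr _ (fun i _ => AB i j)) => /addIr.
by apply/matrixP=> i j; case: (unliftP ord0 i) => [k|] ->.
Qed.

Theorem theorem4 (R : realType) (n : nat) (hn : (0 < n)%N)
    (e : set 'M[R]_n) (he : is_edge (@birkhoff R n) e)
    (D : 'M[R]_n) (hD : is_edge_dir (@birkhoff R n) e D) :
  mxdot (Vmx R n) D != 0.
Proof.
have [A [B [[vA _] [vB _] AB ->]]] := hD.
rewrite mxdotDr mxdotNr subr_eq0; apply/eqP => eqV; apply: AB.
by apply: mxdot_Vmx_inj eqV; (apply: vertex_sub || apply: vertex_birkhoff_01).
Qed.
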